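(* Let $D$ be a finite set with $m+1$ elements ($m\ge1$), $n\ge1$, $k\ge0$, $\epsilon\ge0$ and $0\le\delta<1$. The discrete exponential mechanism $\{X_{\mathbf{d}}\mid\mathbf{d}\in D^n\}$ with utility $u(\mathbf{d},\mathbf{d}')=-k\,h(\mathbf{d},\mathbf{d}')$ is $(\epsilon,\delta)$-differentially private if and only if $$e^k\le\frac{e^{\epsilon}+m\delta}{1-\delta}.$$
   Context: The discrete exponential mechanism with utility $u$ is the family of $D^n$-valued random variables $X_{\mathbf{d}}$ with $\mathbb{P}(X_{\mathbf{d}}=\mathbf{d}')=C_{\mathbf{d}}^{-1}e^{u(\mathbf{d},\mathbf{d}')}$, $C_{\mathbf{d}}=\sum_{\mathbf{d}'\in D^n}e^{u(\mathbf{d},\mathbf{d}')}$. $h$ is the Hamming distance (number of differing coordinates); $\mathbf{d}\sim\mathbf{d}'$ means $h(\mathbf{d},\mathbf{d}')=1$. A mechanism $\{X_{\mathbf{d}}\}$ is $(\epsilon,\delta)$-differentially private if $\mathbb{P}(X_{\mathbf{d}}\in A)\le e^{\epsilon}\mathbb{P}(X_{\mathbf{d}'}\in A)+\delta$ for all $\mathbf{d}\sim\mathbf{d}'$ in $D^n$ (in both orders) and all $A\subseteq D^n$. *)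

(* Defs.v *)
From HB Require Import structures.
From mathcomp Require Import all_boot all_order all_algebra.
From mathcomp Require Import all_classical all_reals all_analysis.

Set Implicit Arguments.
Unset Strict Implicit.
Unset Printing Implicit Defensive.

Import Order.TTheory GRing.Theory Num.Theory.

Local Open Scope classical_set_scope.
Local Open Scope ring_scope.

Definition hamming (D : finType) (n : nat) (x y : n.-tuple D) : nat :=
  #|[pred i : 'I_n | tnth x i != tnth y i]|.

Definition neighbours (D : finType) (n : nat) (x y : n.-tuple D) : Prop :=
  hamming x y = 1%N.

(* D^n carries the discrete sigma-algebra. Measurability of X_x is spelled out
   because the library's measurable types are pointed, whereas D is arbitrary. *)
Record mechanism (disp : measure_display) (Omega : measurableType disp)
    (R : realType) (P : probability Omega R) (D : finType) (n : nat) := Mechanism {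
  mech_fun :> n.-tuple D -> Omega -> n.-tuple D ;
  mech_measurable : forall (x : n.-tuple D) (A : set (n.-tuple D)),
    measurable (mech_fun x @^-1` A) }.

Definition exp_normalizer (R : realType) (D : finType) (n : nat)
    (u : n.-tuple D -> n.-tuple D -> R) (x : n.-tuple D) : R :=
  \sum_(y : n.-tuple D) expR (u x y).

Definition is_exponential_mechanism (disp : measure_display)
    (Omega : measurableType disp) (R : realType) (P : probability Omega R)
    (D : finType) (n : nat) (u : n.-tuple D -> n.-tuple D -> R)
    (X : mechanism P D n) : Prop :=
  forall x y : n.-tuple D,
    P (X x @^-1` [set y]) = ((exp_normalizer u x)^-1 * expR (u x y))%:E.

Definition differentially_private (disp : measure_display)
    (Omega : measurableType disp) (R : realType) (P : probability Omega R)
    (D : finType) (n : nat) (eps delta : R) (X : mechanism P D n) : Prop :=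
  forall x y : n.-tuple D, neighbours x y -> forall A : set (n.-tuple D),
    (P (X x @^-1` A) <= (expR eps)%:E * P (X y @^-1` A) + delta%:E)%E.

(* Main.v *)
Require Import Defs.
From HB Require Import structures.
From mathcomp Require Import all_boot all_order all_algebra.
From mathcomp Require Import all_classical all_reals all_analysis.
From mathcomp Require Import perm lra.

Import Order.TTheory GRing.Theory Num.Theory.

Local Open Scope classical_set_scope.
Local Open Scope ring_scope.

(* Put q = exp (- k), let x and y differ only in coordinate i, and let S be the
   set of z with z_i = x_i. Changing coordinate i shows that X_x charges every
   other fibre of the i-th projection q times as much as S, so
   P (X_x \in S) = 1 / (1 + m q). On S the law of X_y is q times that of X_x,
   and off S it dominates the law of X_x. Hence S is the extremal event, and
   privacy amounts to 1 - exp eps * q <= delta * (1 + m q). *)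

(** * Hamming distance under a change of one coordinate *)

Section Hamming.
Set Implicit Arguments.
Unset Strict Implicit.
Variables (D : finType) (n : nat).
Implicit Types (x y z : n.-tuple D) (i : 'I_n) (a b : D).

Lemma hammingE i x y :
  hamming x y = ((tnth x i != tnth y i) +
                 \sum_(j < n | j != i) (tnth x j != tnth y j))%N.
Proof. by rewrite /hamming -sum1_card big_mkcond (bigD1 i). Qed.

Lemma hammingC x y : hamming x y = hamming y x.
Proof. by apply: eq_card => j; rewrite !inE eq_sym. Qed.

Definition agree_off i x y := forall j, j != i -> tnth x j = tnth y j.

Lemma hamming_agree_off i x y z : agree_off i x y -> tnth x i = tnth z i ->
  tnth y i != tnth z i -> hamming y z = (hamming x z).+1.
Proof.
move=> xy xz yz; rewrite !(hammingE i) xz eqxx yz add0n add1n; congr S.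
by apply: eq_bigr => j ji; rewrite xy.
Qed.

(** Coordinate [i] already contributes its maximum 1 to [hamming x z], and the other coordinates
    contribute equally to both sides. *)
Lemma leq_hamming_agree_off i x y z : agree_off i x y -> tnth x i != tnth z i ->
  (hamming y z <= hamming x z)%N.
Proof.
move=> xy xz; rewrite !(hammingE i) xz leq_add ?leq_b1 //.
by rewrite leq_eqVlt; apply/orP; left; apply/eqP/eq_bigr => j ji; rewrite xy.
Qed.

Lemma neighboursP x y : neighbours x y ->
  exists2 i, tnth x i != tnth y i & agree_off i x y.
Proof.
move=> /eqP/fintype.card1P [i Hi]; exists i => [|j ji].
  by have := Hi i; rewrite !inE eqxx.
by have := Hi j; rewrite !inE (negbTE ji) => /negbFE/eqP.
Qed.

(** A transposition of values, rather than overwriting coordinate [i], makes this an involutive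
    isometry of $D^n$, hence fit for reindexing sums. *)
Definition swap_coord i a b x : n.-tuple D :=
  [tuple if j == i then tperm a b (tnth x j) else tnth x j | j < n].

Lemma tnth_swap_coord i a b x :
  tnth (swap_coord i a b x) i = tperm a b (tnth x i).
Proof. by rewrite tnth_mktuple eqxx. Qed.

Lemma agree_off_swap_coord i a b x : agree_off i x (swap_coord i a b x).
Proof. by move=> j ji; rewrite tnth_mktuple (negbTE ji). Qed.

Lemma swap_coordK i a b : involutive (swap_coord i a b).
Proof.
move=> x; apply: eq_from_tnth => j; rewrite !tnth_mktuple.
by case: eqP => // _; rewrite tpermK.
Qed.

Lemma hamming_swap_coord i a b x y :
  hamming (swap_coord i a b x) (swap_coord i a b y) = hamming x y.
Proof.
apply: eq_card => j; rewrite !inE !tnth_mktuple.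
by case: (j == i); rewrite ?(inj_eq perm_inj).
Qed.

Lemma swap_coord_agree_off i x y : agree_off i x y ->
  swap_coord i (tnth x i) (tnth y i) x = y.
Proof.
move=> xy; apply: eq_from_tnth => j; rewrite tnth_mktuple.
by case: eqP => [->|/eqP/xy //]; rewrite tpermL.
Qed.

End Hamming.

(** * The law with weights [q ^+ hamming x z], for an abstract ratio [q] *)

Section GeometricWeights.
Set Implicit Arguments.
Unset Strict Implicit.
Variables (R : realFieldType) (D : finType) (n : nat) (q : R).
Hypothesis q_gt0 : 0 < q.
Implicit Types (x y z : n.-tuple D) (i : 'I_n).

Definition hamming_mass x : R := \sum_(z : n.-tuple D) q ^+ hamming x z.

Definition hamming_law x z : R := (hamming_mass x)^-1 * q ^+ hamming x z.

Lemma hamming_mass_gt0 x : 0 < hamming_mass x.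
Proof.
rewrite /hamming_mass (bigD1 x) //= ltr_pwDl ?exprn_gt0 //.
by apply: sumr_ge0 => z _; rewrite exprn_ge0 // ltW.
Qed.

Lemma hamming_law_ge0 x z : 0 <= hamming_law x z.
Proof. by rewrite mulr_ge0 ?invr_ge0 ?exprn_ge0 ?ltW ?hamming_mass_gt0. Qed.

Lemma sum_hamming_law x : \sum_z hamming_law x z = 1.
Proof. by rewrite -mulr_sumr mulVf // gt_eqF // hamming_mass_gt0. Qed.

(** The isometry exchanging [tnth x i] and [tnth y i] in coordinate [i] carries [x] to [y], so it
    merely permutes the terms of the sum. *)
Lemma hamming_mass_agree_off i x y : agree_off i x y ->
  hamming_mass y = hamming_mass x.
Proof.
move=> xy; rewrite /hamming_mass.
rewrite (reindex_inj (inv_inj (swap_coordK i (tnth x i) (tnth y i)))) /=.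
by apply: eq_bigr => z _; rewrite -{1}(swap_coord_agree_off xy) hamming_swap_coord.
Qed.

Lemma hamming_law_agree_off i x y z : agree_off i x y -> tnth x i = tnth z i ->
  tnth y i != tnth z i -> hamming_law y z = q * hamming_law x z.
Proof.
move=> xy xz yz; rewrite /hamming_law (hamming_mass_agree_off xy).
by rewrite (hamming_agree_off xy xz yz) exprS mulrCA.
Qed.

Lemma le_hamming_law_agree_off i x y z : q <= 1 -> agree_off i x y ->
  tnth x i != tnth z i -> hamming_law x z <= hamming_law y z.
Proof.
move=> q1 xy xz; rewrite /hamming_law (hamming_mass_agree_off xy).
rewrite ler_pM2l ?invr_gt0 ?hamming_mass_gt0 //.
by rewrite ler_wiXn2l ?(leq_hamming_agree_off xy) // ltW.
Qed.

(* Swapping the values [tnth x i] and [b] in coordinate [i] carries one fibre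
   of the [i]-th projection onto the other and multiplies the weight by [q]. *)
Lemma sum_hamming_law_fibre x i b : b != tnth x i ->
  \sum_(z | tnth z i == b) hamming_law x z =
  q * \sum_(z | tnth z i == tnth x i) hamming_law x z.
Proof.
move=> bx; rewrite mulr_sumr.
rewrite (reindex_inj (inv_inj (swap_coordK i (tnth x i) b))) /=.
apply: eq_big => [z|z].
  by rewrite tnth_swap_coord -{2}(tpermL (tnth x i) b) (inj_eq perm_inj).
rewrite tnth_swap_coord -{2}(tpermL (tnth x i) b) (inj_eq perm_inj) => /eqP zx.
rewrite /hamming_law ![hamming x _]hammingC mulrCA; congr (_ * _).
rewrite (hamming_agree_off (@agree_off_swap_coord _ _ i (tnth x i) b z)) ?exprS //.
by rewrite tnth_swap_coord zx tpermL.
Qed.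

(** The total mass 1 splits over the fibres of the [i]-th projection: the one through [x], and [m]
    others weighing [q] times as much. *)
Lemma sum_hamming_law_centre m x i : #|D| = m.+1 ->
  (1 + m%:R * q) * \sum_(z | tnth z i == tnth x i) hamming_law x z = 1.
Proof.
move=> cD; rewrite -[RHS](sum_hamming_law x).
rewrite [RHS](partition_big (fun z => tnth z i) predT) //=.
rewrite [RHS](bigD1 (tnth x i)) //=.
under [X in _ = _ + X]eq_bigr => b bx do rewrite sum_hamming_law_fibre //.
rewrite sumr_const mulrDl mul1r; congr (_ + _).
have -> : #|[pred b | b != tnth x i]| = m.
  by have := cardC1 (tnth x i); rewrite cD.
by rewrite -[RHS]mulr_natl mulrA.
Qed.

Lemma sum_hamming_law_le m (e d : R) (A : pred (n.-tuple D)) i x y :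
  #|D| = m.+1 -> q <= 1 -> 1 <= e -> 0 <= d ->
  1 - e * q <= d * (1 + m%:R * q) -> tnth x i != tnth y i -> agree_off i x y ->
  \sum_(z | A z) hamming_law x z <= e * (\sum_(z | A z) hamming_law y z) + d.
Proof.
move=> cD q1 e1 d0 eqd xyi xy.
(* Spreading [d] over the fibre through [x], proportionally to the law of [x], reduces the claim to
   a comparison term by term. *)
have Hd : d = \sum_(z | tnth z i == tnth x i)
                d * (1 + m%:R * q) * hamming_law x z.
  by rewrite -mulr_sumr -mulrA (sum_hamming_law_centre x i cD) mulr1.
have dm0 : 0 <= d * (1 + m%:R * q).
  by rewrite mulr_ge0 // addr_ge0 // mulr_ge0 // ltW.
rewrite {}Hd mulr_sumr ![\sum_(z | A z) _]big_mkcond/=.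
rewrite [X in _ + X]big_mkcond/= -big_split/=; apply: ler_sum => z _.
have p0 := hamming_law_ge0 x z; have p'0 := hamming_law_ge0 y z.
case: ifPn => _; last first.
  by rewrite add0r; case: ifP => // _; rewrite mulr_ge0.
(* On the fibre the term of [y] is [q] times that of [x], and the hypothesis gives
   [1 <= e * q + d * (1 + m%:R * q)]. Off it, the term of [y] dominates and [1 <= e] suffices. *)
case: ifPn => [/eqP zx|zx].
  rewrite (hamming_law_agree_off xy) ?zx //; last by rewrite eq_sym.
  by rewrite mulrA -mulrDl ler_peMl // -lerBlDl.
rewrite addr0 (le_trans (le_hamming_law_agree_off q1 xy _)) ?ler_peMl //.
by rewrite eq_sym.
Qed.

(** If [S] is the mass of the fibre under the law of [x], the assumption reads
    [S <= e * (q * S) + d]; multiplying by [1 + m%:R * q], the inverse of [S], removes [S]. *)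
Lemma sum_hamming_law_centre_le m (e d : R) i x y : #|D| = m.+1 ->
  tnth x i != tnth y i -> agree_off i x y ->
  \sum_(z | tnth z i == tnth x i) hamming_law x z <=
    e * (\sum_(z | tnth z i == tnth x i) hamming_law y z) + d ->
  1 - e * q <= d * (1 + m%:R * q).
Proof.
move=> cD xyi xy.
have -> : \sum_(z | tnth z i == tnth x i) hamming_law y z =
          q * \sum_(z | tnth z i == tnth x i) hamming_law x z.
  rewrite mulr_sumr; apply: eq_bigr => z /eqP zx.
  by rewrite (hamming_law_agree_off xy) ?zx // eq_sym.
have := sum_hamming_law_centre x i cD; set S := \sum_(z | _) _ => HS H.
have M0 : 0 <= 1 + m%:R * q by rewrite addr_ge0 // mulr_ge0 // ltW.
have := ler_wpM2l M0 H; rewrite HS mulrDr mulrCA [_ * (q * S)]mulrCA HS mulr1.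
by rewrite lerBlDl [d * _]mulrC.
Qed.

End GeometricWeights.

(** * From probabilities to finite sums, and the equivalence *)

Lemma mechanism_preimage_sum (disp : measure_display)
    (Omega : measurableType disp) (R : realType) (P : probability Omega R)
    (D : finType) (n : nat) (X : mechanism P D n) (p : n.-tuple D -> R) x
    (A : set (n.-tuple D)) :
  (forall z, P (X x @^-1` [set z]) = (p z)%:E) ->
  P (X x @^-1` A) = (\sum_(z | `[< A z >]) p z)%:E.
Proof.
(* Listing [A] without repetition turns its preimage into a finite disjoint union of preimages of
   points. *)
move=> HP; pose r := [seq z <- index_enum (n.-tuple D) | `[< A z >]].
have Ar : A = [set` r].
  apply/seteqP; split => z; rewrite /= mem_filter mem_index_enum andbT.
    by move=> /asboolP.
  by move=> /asboolP.
have ur : uniq r by rewrite filter_uniq ?index_enum_uniq.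
have -> : X x @^-1` A = \bigcup_(z in [set` r]) X x @^-1` [set z].
  rewrite -Ar; apply/seteqP; split=> [w Aw|w [z Az zw]].
    by exists (X x w).
  by rewrite /preimage/= zw.
rewrite measure_fin_bigcup //.
- rewrite -fsbig_seq // big_filter -sumEFin.
  by apply: eq_bigr => z _; exact: HP.
- exact: trivIset_preimage1.
- by move=> z _; exact: mech_measurable.
Qed.

Theorem theorem4 (R : realType) (D : finType) (m n : nat) (k eps delta : R)
    (hm : (1 <= m)%N) (hD : #|D| = m.+1) (hn : (1 <= n)%N)
    (hk : 0 <= k) (heps : 0 <= eps) (hdelta0 : 0 <= delta) (hdelta1 : delta < 1)
    (disp : measure_display) (Omega : measurableType disp)
    (P : probability Omega R) (X : mechanism P D n)
    (hX : is_exponential_mechanism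
            (fun x y : n.-tuple D => - k * (hamming x y)%:R) X) :
  differentially_private eps delta X <->
  expR k <= (expR eps + m%:R * delta) / (1 - delta).
Proof.
pose q := expR (- k).
have q0 : 0 < q by exact: expR_gt0.
have q1 : q <= 1 by rewrite -expR0 ler_expR oppr_le0.
have hq h : expR (- k * h%:R) = q ^+ h by rewrite expRM_natr.
have Plaw x A : P (X x @^-1` A) = (\sum_(z | `[< A z >]) hamming_law q x z)%:E.
  apply: mechanism_preimage_sum => z; rewrite hX hq; congr (_^-1 * _)%:E.
  by apply: eq_bigr => y _; rewrite hq.
(* Clear the denominator [1 - delta > 0] and multiply by [q], using [q * expR k = 1]. *)
have -> : expR k <= (expR eps + m%:R * delta) / (1 - delta) <->
          1 - expR eps * q <= delta * (1 + m%:R * q).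
  rewrite ler_pdivlMr ?subr_gt0 // -(ler_pM2l q0) mulrA -expRD addNr expR0 mul1r.
  by split; lra.
split=> [dp|le_delta x y /neighboursP[i xyi xy] A].
  have [a [b ab]] : exists a b : D, a != b.
    have /card_gt1P[a [b [_ _ ab]]] : (1 < #|D|)%N by rewrite hD.
    by exists a, b.
  (* [hn] supplies coordinate 0; [x] is constantly [a], and [y] has [b] there instead. *)
  pose i := Ordinal hn; pose x := [tuple a | j < n]; pose y := swap_coord i a b x.
  have xy : agree_off i x y by exact: agree_off_swap_coord.
  have xyi : tnth x i != tnth y i.
    by rewrite tnth_swap_coord tnth_mktuple tpermL.
  have nxy : neighbours x y.
    (* Taking [x] itself as third point gives [hamming y x = (hamming x x).+1]. *)
    rewrite /neighbours hammingC (hamming_agree_off xy) //; last by rewrite eq_sym.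
    by congr S; apply: eq_card0 => j; rewrite !inE eqxx.
  apply: (sum_hamming_law_centre_le q0 hD xyi xy).
  have := dp x y nxy [set z | tnth z i == tnth x i].
  rewrite !Plaw -EFinM -EFinD lee_fin.
  by under eq_bigl do rewrite asboolb; under [X in _ * X]eq_bigl do rewrite asboolb.
rewrite !Plaw -EFinM -EFinD lee_fin.
have e1 : 1 <= expR eps by rewrite -expR0 ler_expR.
exact: (sum_hamming_law_le q0 _ hD q1 e1 hdelta0 le_delta xyi xy).
Qed.
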